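(* The interpolant which solves Problem (PL2) with $f(x(t),t)=\sqrt{x(t)}$ is a quadratic on each stage, namely $$x(t) = \frac{t^2}{4} + c_1\,t + c_2,$$ for all $t\in[t_{i-1},t_i]$, and all $i=1,\ldots,N$, where $$c_1 = \frac{1}{t_i-t_{i-1}}\left(z_i - z_{i-1} - \frac{t_i^2 - t_{i-1}^2}{4}\right)\quad\text{and}\quad c_2 = z_{i-1} - \frac{t_{i-1}^2}{4} - t_{i-1}\,c_1$$ (depending on the stage $i$). The residual is in turn given by $$u(t) = \frac{t}{2} + c_1 - \sqrt{x(t)},$$ for all $t\in[t_{i-1},t_i]$, and all $i=1,\ldots,N$.
   Context: Let $0=t_0<t_1<\cdots<t_N=:t_f$ and let $z_0=1,z_1,\ldots,z_N>0$ (the skeleton) satisfy $z_i\ne z_{i-1}$, $i=1,\ldots,N$. The underlying ODE is $\dot z(t)=\sqrt{z(t)}$, $z(0)=1$. The interpolant is assumed to satisfy $x(t)>0$ for all $t\in[t_0,t_f]$. Problem (PL2): minimize $\frac12\sum_{i=1}^N\int_{t_{i-1}}^{t_i}|\dot x(t)-f(x(t),t)|^2dt$ over (positive) curves $x\in W^{1,\infty}(t_0,t_f;\mathbb{R})$ subject to $x(t_i)=z_i$, $i=0,\ldots,N$. The residual of $x$ is $u(t):=\dot x(t)-f(x(t),t)$; it may jump at the nodes $t_1,\ldots,t_{N-1}$, and the formulas are to be read separately on each stage $[t_{i-1},t_i]$. *)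

(* Defs.v *)
From mathcomp Require Export all_boot all_order all_algebra.
From mathcomp Require Export all_classical all_reals all_analysis.
Export Order.TTheory GRing.Theory Num.Theory.
Export numFieldNormedType.Exports.

Set Implicit Arguments.
Unset Strict Implicit.
Unset Printing Implicit Defensive.

Local Open Scope classical_set_scope.
Local Open Scope ring_scope.

(* MathComp-Analysis development over an arbitrary [R : realType].

   Curves are total functions [R -> R] of which only the values on the time
   interval matter.  Nodes and skeleton are sequences [t z : nat -> R] read at
   the indices 0..N; stage [i] (for [i < N]) is [t_i, t_(i+1)]. *)

Definition Loo (R : realType) (a b : R) (g : R -> R) : Prop :=
  g \_ `]a, b[ \in Lfun (@lebesgue_measure R) +oo%E.

(* C^1 functions with compact support in the open interval ]a, b[. *)
Definition test_function (R : realType) (a b : R) (phi : R -> R) : Prop :=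
  [/\ forall s, derivable phi s 1,
      continuous (derive1 phi) &
      exists K : set R, [/\ compact K, K `<=` `]a, b[ &
        forall s, ~ K s -> phi s = 0]].

Definition weak_derivative (R : realType) (a b : R) (x g : R -> R) : Prop :=
  forall phi, test_function a b phi ->
    (\int[lebesgue_measure]_(s in `]a, b[) (x s * derive1 phi s) =
     - \int[lebesgue_measure]_(s in `]a, b[) (g s * phi s))%R.

(* An element of W^{1,oo}(a, b) is an almost-everywhere class; it is given here
   by its representative continuous on [a, b], so that pointwise conditions
   such as x(t_i) = z_i make sense. *)
Definition W1oo (R : realType) (a b : R) (x : R -> R) : Prop :=
  [/\ {within `[a, b], continuous x},
      Loo a b x &
      exists2 g, Loo a b g & weak_derivative a b x g].

(* The derivative of x in W^{1,oo}(a, b), unique up to a null subset of ]a, b[;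
   the zero function is a dummy value for x outside W^{1,oo}(a, b). *)
Definition wderiv (R : realType) (a b : R) (x : R -> R) : R -> R :=
  xget (cst 0) [set g | Loo a b g /\ weak_derivative a b x g].

Definition residual (R : realType) (f : R -> R -> R) (a b : R) (x : R -> R)
    (s : R) : R :=
  wderiv a b x s - f (x s) s.

Definition PL2_cost (R : realType) (f : R -> R -> R) (N : nat) (t : nat -> R)
    (x : R -> R) : \bar R :=
  ((2^-1)%:E * \sum_(i < N)
    \int[lebesgue_measure]_(s in `[t i, t i.+1])
      (`|residual f (t 0%N) (t N) x s| ^+ 2)%:E)%E.

Definition PL2_feasible (R : realType) (N : nat) (t z : nat -> R)
    (x : R -> R) : Prop :=
  [/\ W1oo (t 0%N) (t N) x,
      forall s, s \in `[t 0%N, t N] -> 0 < x s &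
      forall i, (i <= N)%N -> x (t i) = z i].

Definition solves_PL2 (R : realType) (f : R -> R -> R) (N : nat)
    (t z : nat -> R) (x : R -> R) : Prop :=
  PL2_feasible N t z x /\
  forall y, PL2_feasible N t z y -> (PL2_cost f N t x <= PL2_cost f N t y)%E.

(* [d] is the derivative at s of the restriction of x to [a, b]: two-sided in
   the interior, one-sided at a and b. *)
Definition stage_derivative (R : realType) (a b : R) (x : R -> R) (s d : R) :
    Prop :=
  (x r - x s) / (r - s) @[r --> within `[a, b] s^'] --> d.

(* [u] is the value at s of the residual read on the stage [a, b] alone; this
   fixes it at every point of the closed stage, where [residual] is defined
   only almost everywhere. *)
Definition stage_residual (R : realType) (f : R -> R -> R) (a b : R)
    (x : R -> R) (s u : R) : Prop :=
  exists2 d, stage_derivative a b x s d & u = d - f (x s) s.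

(* Main.v *)
Require Import Defs.
From mathcomp Require Import measurable_realfun ess_sup_inf.
From mathcomp Require Import ring lra.

(* Since x' sqrt x is a total derivative, the cost of a stage [c, d] is, up to a
   term depending only on x(c) and x(d), half the integral of x'^2 + x, hence of
   (x' - p)^2 where p(s) = s / 2 + c1 is the derivative of the claimed
   quadratic q. Replacing x by x + e (q - x) on that stage is admissible for
   small e > 0 (positivity is kept because x is bounded away from 0, although q
   itself need not be positive) and multiplies the integral of (x' - p)^2 by
   (1 - e)^2. Minimality forces this integral to vanish.

   Absolute continuity is avoided: W^{1,oo} curves are Lipschitz, and the
   product and chain rules follow from the fact that a function whose
   increments are those of an integral up to O((v - u)^2) is a primitive of the
   integrand. *)

Set Implicit Arguments.
Unset Strict Implicit.
Unset Printing Implicit Defensive.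

Local Open Scope classical_set_scope.
Local Open Scope ring_scope.

(** * Bounded measurable functions on a segment *)

Section bounded_measurable.
Variable R : realType.
Implicit Types (a b u v M C : R) (f g F G : R -> R).
Local Notation mu := (@lebesgue_measure R).

(** The bound holds everywhere, not just almost everywhere, so that integrands can be estimated
    pointwise; [Loo_bounded] supplies such representatives. *)
Definition bmeas a b f : Prop :=
  measurable_fun `[a, b] f /\
  exists M, forall s, s \in `[a, b] -> `|f s| <= M.

Lemma bmeas_sub a b u v f : a <= u -> v <= b -> bmeas a b f -> bmeas u v f.
Proof.
move=> au vb [mf [M fM]]; have sub : `[u, v] `<=` `[a, b].
  by apply: subset_itv; rewrite bnd_simp.
split; first exact: measurable_funS mf.
by exists M => s /sub; exact: fM.
Qed.

Lemma eq_bmeas a b f g : {in `[a, b], f =1 g} -> bmeas a b f -> bmeas a b g.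
Proof.
move=> fg [mf [M fM]]; split.
  by apply: eq_measurable_fun mf => s; rewrite inE => /fg.
by exists M => s sab; rewrite -fg// fM.
Qed.

Lemma bmeas_cst a b M : bmeas a b (cst M).
Proof. by split; [exact: measurable_cst|exists `|M|]. Qed.

Lemma bmeasD a b f g : bmeas a b f -> bmeas a b g ->
  bmeas a b (fun s => f s + g s).
Proof.
move=> [mf [M fM]] [mg [M' gM]]; split; first exact: measurable_funD.
exists (M + M') => s sab.
by rewrite (le_trans (ler_normD _ _))// lerD ?fM ?gM.
Qed.

Lemma bmeasM a b f g : bmeas a b f -> bmeas a b g ->
  bmeas a b (fun s => f s * g s).
Proof.
move=> [mf [M fM]] [mg [M' gM]]; split; first exact: measurable_funM.
by exists (M * M') => s sab; rewrite normrM ler_pM ?fM ?gM.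
Qed.

Lemma bmeasN a b f : bmeas a b f -> bmeas a b (fun s => - f s).
Proof.
move=> /(bmeasM (bmeas_cst a b (-1))); apply: eq_bmeas => s _ /=.
by rewrite mulN1r.
Qed.

Lemma bmeasB a b f g : bmeas a b f -> bmeas a b g ->
  bmeas a b (fun s => f s - g s).
Proof. by move=> bf bg; apply: bmeasD => //; exact: bmeasN. Qed.

Lemma bmeas_continuous a b f : {within `[a, b], continuous f} -> bmeas a b f.
Proof.
move=> cf; split; first exact: subspace_continuous_measurable_fun.
have /compact_bounded [M [_ fM]] : compact (f @` `[a, b]).
  by apply: continuous_compact => //; exact: segment_compact.
exists (`|M| + 1) => s sab; apply: fM; last by exists s.
by rewrite (le_lt_trans (ler_norm _))// ltrDl.
Qed.

Lemma bmeas_integrable a b f : bmeas a b f ->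
  mu.-integrable `[a, b] (EFin \o f).
Proof.
move=> [mf [M fM]]; apply: measurable_bounded_integrable => //.
  by rewrite /= lebesgue_measure_itv/=; case: ifP => // _; rewrite -EFinD ltry.
exists M; split; first exact: num_real.
by move=> x Mx s /fM/le_trans; apply; exact: ltW.
Qed.

Lemma Rintegral_le a b f C : a <= b -> bmeas a b f ->
  {in `[a, b], forall s, `|f s| <= C} ->
  `|\int[mu]_(s in `[a, b]) f s| <= C * (b - a).
Proof.
move=> ab bf fC; have fi := bmeas_integrable bf.
have ni : mu.-integrable `[a, b] (EFin \o (fun s => `|f s|)).
  exact: (integrable_norm fi).
apply: (le_trans (le_normr_Rintegral _ fi)) => //.
have -> : C * (b - a) = \int[mu]_(s in `[a, b]) C.
  rewrite Rintegral_cst//= lebesgue_measure_itv/= lte_fin.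
  by case: ltP => //= ba; rewrite -(le_anti (introT andP (conj ab ba))) subrr.
apply: le_Rintegral => //; exact: (bmeas_integrable (bmeas_cst a b C)).
Qed.

Lemma Rintegral_cat a u b f : a <= u -> u <= b -> bmeas a b f ->
  \int[mu]_(s in `[a, b]) f s =
  \int[mu]_(s in `[a, u]) f s + \int[mu]_(s in `[u, b]) f s.
Proof.
move=> au ub bf; have fi := bmeas_integrable bf.
rewrite -[X in _ = _ + X]Rintegral_itv_obnd_cbnd; last first.
  apply: integrableS fi => //; apply: subset_itvr.
  by rewrite bnd_simp.
by rewrite -(Rintegral_itvB fi) ?bnd_simp// subrKC.
Qed.

Lemma Rintegral_open a b f : bmeas a b f ->
  \int[mu]_(s in `]a, b[) f s = \int[mu]_(s in `[a, b]) f s.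
Proof.
move=> bf; have fi := bmeas_integrable bf.
rewrite Rintegral_itv_bndo_bndc ?Rintegral_itv_obnd_cbnd//.
  by apply: integrableS fi => //; apply: subset_itvr; rewrite bnd_simp.
by apply: integrableS fi => //; apply: subset_itv; rewrite bnd_simp.
Qed.

Lemma RintegralDb a b f g : bmeas a b f -> bmeas a b g ->
  \int[mu]_(s in `[a, b]) (f s + g s) =
  \int[mu]_(s in `[a, b]) f s + \int[mu]_(s in `[a, b]) g s.
Proof.
by move=> bf bg; rewrite RintegralD//; exact: bmeas_integrable.
Qed.

Lemma RintegralZb a b c f : bmeas a b f ->
  \int[mu]_(s in `[a, b]) (c * f s) = c * \int[mu]_(s in `[a, b]) f s.
Proof. by move=> bf; rewrite RintegralZl//; exact: bmeas_integrable. Qed.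

Lemma RintegralBb a b f g : bmeas a b f -> bmeas a b g ->
  \int[mu]_(s in `[a, b]) (f s - g s) =
  \int[mu]_(s in `[a, b]) f s - \int[mu]_(s in `[a, b]) g s.
Proof.
by move=> bf bg; rewrite RintegralB//; exact: bmeas_integrable.
Qed.

(** Cutting [[a, b]] into [n + 1] equal pieces bounds the total increment by
    [C (b - a)^2 / (n + 1)], which is arbitrarily small. *)
Lemma quadratic_increments_cst a b C F : a <= b ->
  (forall u v, a <= u -> u <= v -> v <= b ->
    `|F v - F u| <= C * (v - u) ^+ 2) ->
  F b = F a.
Proof.
move=> ab FC; apply/eqP; rewrite -subr_eq0 -normr_le0.
have step n : `|F b - F a| <= C * (b - a) ^+ 2 / n.+1%:R.
  have n0 : n.+1%:R != 0 :> R by rewrite pnatr_eq0.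
  pose d := (b - a) / n.+1%:R.
  have d0 : 0 <= d by rewrite divr_ge0// subr_ge0.
  have dn : d * n.+1%:R = b - a by rewrite /d divfK.
  have H k : (k <= n.+1)%N -> `|F (a + d * k%:R) - F a| <= k%:R * (C * d ^+ 2).
    elim: k => [_|k IH kn]; first by rewrite mulr0 addr0 subrr normr0 mul0r.
    have kd : d * k.+1%:R = d * k%:R + d by rewrite -natr1 mulrDr mulr1.
    have h1 : a <= a + d * k%:R by rewrite lerDl mulr_ge0.
    have h2 : a + d * k%:R <= a + d * k.+1%:R by rewrite kd addrA lerDl.
    have h3 : a + d * k.+1%:R <= b.
      by rewrite -lerBrDl -dn ler_wpM2l// ler_nat.
    have := FC _ _ h1 h2 h3.
    have -> : a + d * k.+1%:R - (a + d * k%:R) = d by rewrite kd; ring.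
    move=> h; have := ler_normD (F (a + d * k.+1%:R) - F (a + d * k%:R))
      (F (a + d * k%:R) - F a).
    rewrite subrKA => /le_trans; apply.
    rewrite -[in leRHS]natr1 mulrDl mul1r [leRHS]addrC.
    by apply: lerD; [exact: h|exact: IH (ltnW kn)].
  have := H n.+1 (leqnn _); rewrite dn subrKC => /le_trans; apply.
  suff -> : C * (b - a) ^+ 2 / n.+1%:R = n.+1%:R * (C * d ^+ 2) by [].
  have aux (c e m : R) : m != 0 -> c * (e * m) ^+ 2 / m = m * (c * e ^+ 2).
    by move=> m0; field.
  by rewrite -dn aux.
rewrite leNgt; apply/negP => h0.
(* If the increment were nonzero, an integer [n] above this quotient would contradict [step n]. *)
have := @archi_boundP _ (C * (b - a) ^+ 2 / `|F b - F a|).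
have C0 : 0 <= C * (b - a) ^+ 2.
  by apply: le_trans (ltW h0) _; have := step 0%N; rewrite divr1.
rewrite divr_ge0// => /(_ isT); set n := Num.bound _.
rewrite ltr_pdivrMr// => hn.
have := step n; rewrite ler_pdivlMr ?ltr0n// => hs.
have : `|F b - F a| * n%:R <= `|F b - F a| * n.+1%:R.
  by rewrite ler_wpM2l// ler_nat.
rewrite mulrC in hn; lra.
Qed.

(** [F] minus the running integral of [f] has quadratically small increments, hence is constant. *)
Lemma quadratic_increments_FTC a b C F f : a <= b -> bmeas a b f ->
  (forall u v, a <= u -> u <= v -> v <= b ->
    `|F v - F u - \int[mu]_(s in `[u, v]) f s| <= C * (v - u) ^+ 2) ->
  F b - F a = \int[mu]_(s in `[a, b]) f s.
Proof.
move=> ab bf Ff.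
pose D v := F v - \int[mu]_(s in `[a, v]) f s.
have /= : D b = D a.
  apply: (quadratic_increments_cst ab) => u v au uv vb.
  have := Ff u v au uv vb.
  rewrite /D (Rintegral_cat au uv (bmeas_sub (lexx a) vb bf)).
  by congr (`|_| <= _); ring.
rewrite /D set_itv1 Rintegral_set1 subr0 => <-; ring.
Qed.

End bounded_measurable.

(** * Primitives of bounded measurable functions *)

Section primitives.
Variable R : realType.
Implicit Types (a b u v M C : R) (f g F G : R -> R).
Local Notation mu := (@lebesgue_measure R).

(** Integral form of: [F] is Lipschitz with bounded derivative [f]. It determines [f] only almost
    everywhere. *)
Definition primitive a b F f : Prop :=
  bmeas a b f /\
  forall u v, a <= u -> u <= v -> v <= b ->
    F v - F u = \int[mu]_(s in `[u, v]) f s.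

Lemma primitive_sub a b u v F f : a <= u -> v <= b ->
  primitive a b F f -> primitive u v F f.
Proof.
move=> au vb [bf Ff]; split; first exact: bmeas_sub bf.
move=> s t us st tv.
by apply: Ff => //; [exact: le_trans us|exact: le_trans vb].
Qed.

Lemma eq_primitive a b F G f g : {in `[a, b], F =1 G} -> {in `[a, b], f =1 g} ->
  primitive a b F f -> primitive a b G g.
Proof.
move=> FG fg [bf Ff]; split; first exact: eq_bmeas bf.
move=> u v au uv vb.
have uab : u \in `[a, b] by rewrite in_itv/= au (le_trans uv).
have vab : v \in `[a, b] by rewrite in_itv/= vb (le_trans au).
rewrite -!FG// Ff//; apply: eq_Rintegral => s; rewrite inE/= => /= suv.
apply: fg; rewrite in_itv/= (le_trans au) ?(itvP suv)//.
by rewrite (le_trans _ vb) ?(itvP suv).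
Qed.

(** The bound of [f] is a Lipschitz constant; its absolute value is taken because [M] may be
    negative when [[a, b]] is empty. *)
Lemma primitive_lipschitz a b F f : primitive a b F f ->
  exists2 L, 0 <= L & {in `[a, b] &, forall u v, `|F v - F u| <= L * `|v - u|}.
Proof.
move=> [[mf [M fM]] Ff]; exists `|M| => // u v.
wlog uv : u v / u <= v.
  move=> W; have [|/ltW vu] := leP u v; first exact: W.
  by move=> uab vab; rewrite distrC [`|v - u|]distrC W.
rewrite !in_itv/= => /andP[au ub] /andP[av vb].
rewrite Ff// [`|v - u|]ger0_norm ?subr_ge0//; apply: Rintegral_le => //.
  by apply: bmeas_sub au vb _; split=> //; exists M.
move=> s suv; apply: le_trans (ler_norm _); apply: fM.
rewrite in_itv/= (le_trans au) ?(itvP suv)//.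
by rewrite (le_trans _ vb) ?(itvP suv).
Qed.

Lemma primitive_continuous a b F f : primitive a b F f ->
  {within `[a, b], continuous F}.
Proof.
move=> /primitive_lipschitz[L L0 FL].
apply/subspace_continuousP => s sab; apply/cvgrPdist_le => e e0.
(* Division is by [L + 1] because [L] may be 0. *)
have L1 : 0 < L + 1 by rewrite ltr_wpDl.
near=> r; have rab : r \in `[a, b] by near: r; exact: withinT.
rewrite (le_trans (FL _ _ rab sab))//.
have : `|s - r| <= e / (L + 1).
  near: r; apply: cvg_within; apply/nbhs_ballP.
  exists (e / (L + 1)) => /=; first exact: divr_gt0.
  by move=> r; rewrite /ball/= => /ltW.
rewrite ler_pdivlMr// => h; apply: le_trans h.
by rewrite mulrC ler_wpM2l// lerDl.
Unshelve. all: by end_near. Qed.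

Lemma primitive_bmeas a b F f : primitive a b F f -> bmeas a b F.
Proof. by move=> /primitive_continuous; exact: bmeas_continuous. Qed.

Lemma primitive_lin a b c F G f g : primitive a b F f -> primitive a b G g ->
  primitive a b (fun s => F s + c * G s) (fun s => f s + c * g s).
Proof.
move=> [bf Ff] [bg Gg]; have bcg := bmeasM (bmeas_cst a b c) bg.
split; first exact: bmeasD.
move=> u v au uv vb.
rewrite RintegralDb ?RintegralZb; try by [exact: bmeas_sub au vb _].
by rewrite -Ff// -Gg//; ring.
Qed.

Lemma primitive_cst a b c : primitive a b (fun=> c) (fun=> 0).
Proof.
split; first exact: bmeas_cst.
by move=> u v _ _ _; rewrite subrr Rintegral_cst//= mul0r.
Qed.

Lemma primitive_id a b : primitive a b id (fun=> 1).
Proof.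
split; first exact: bmeas_cst.
move=> u v _ uv _.
rewrite Rintegral_cst//= mul1r lebesgue_measure_itv/= lte_fin.
by case: ltP => //= vu; rewrite -(le_anti (introT andP (conj uv vu))) subrr.
Qed.

Lemma primitive_integral a b f : bmeas a b f ->
  primitive a b (fun s => \int[mu]_(r in `[a, s]) f r) f.
Proof.
move=> bf; split=> // u v au uv vb.
by rewrite (Rintegral_cat au uv (bmeas_sub (lexx a) vb bf)) addrC addKr.
Qed.

(** The increment of [F G] on [[u, v]] is exactly the integral of [F(u) g + G(v) f]. Unfreezing the
    two factors changes the integrand by at most [(L M' + M K) (v - u)]. *)
Lemma primitiveM a b F G f g : primitive a b F f -> primitive a b G g ->
  primitive a b (fun s => F s * G s) (fun s => F s * g s + f s * G s).
Proof.
move=> pF pG; have bF := primitive_bmeas pF; have bG := primitive_bmeas pG.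
have [L L0 FL] := primitive_lipschitz pF.
have [K K0 GK] := primitive_lipschitz pG.
have [bf Ff] := pF; have [bg Gg] := pG.
have b1 : bmeas a b (fun s => F s * g s + f s * G s).
  by apply: bmeasD; exact: bmeasM.
split=> // a' b' aa' a'b' b'b.
have [_ [M fM]] := bf; have [_ [M' gM]] := bg.
apply: (@quadratic_increments_FTC _ _ _ (L * M' + M * K)
  (fun s => F s * G s)) => //.
  exact: bmeas_sub b1.
move=> u v /(le_trans aa') au uv /le_trans/(_ b'b) vb.
have sub h : bmeas a b h -> bmeas u v h by exact: bmeas_sub.
have uab : u \in `[a, b] by rewrite in_itv/= au (le_trans uv).
have vab : v \in `[a, b] by rewrite in_itv/= vb (le_trans au).
have -> : F v * G v - F u * G u =
    \int[mu]_(s in `[u, v]) (F u * g s + G v * f s).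
  rewrite RintegralDb ?RintegralZb;
    try by [exact: sub|apply/sub/bmeasM; [exact: bmeas_cst|]].
  by rewrite -Ff// -Gg//; ring.
have b2 : bmeas u v (fun s => F u * g s + G v * f s).
  by apply/sub/bmeasD; apply/bmeasM => //; exact: bmeas_cst.
have b3 := sub _ b1.
rewrite -RintegralBb// expr2 mulrA; apply: Rintegral_le => //.
  exact: bmeasB.
move=> s suv; have sab : s \in `[a, b].
  rewrite in_itv/= (le_trans au) ?(itvP suv)//.
  by rewrite (le_trans _ vb) ?(itvP suv).
have -> : F u * g s + G v * f s - (F s * g s + f s * G s) =
  (F u - F s) * g s + f s * (G v - G s) by ring.
have us : `|u - s| <= v - u.
  by rewrite ler0_norm ?subr_le0 ?(itvP suv)// opprB lerB// (itvP suv).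
have vs : `|v - s| <= v - u.
  by rewrite ger0_norm ?subr_ge0 ?(itvP suv)// lerB// (itvP suv).
rewrite (le_trans (ler_normD _ _))// [leRHS]mulrDl lerD// normrM.
- rewrite mulrAC ler_pM ?fM ?gM//.
  by rewrite (le_trans (FL _ _ sab uab))// ler_wpM2l.
- rewrite -mulrA ler_pM ?fM ?gM//.
  by rewrite (le_trans (GK _ _ sab vab))// ler_wpM2l.
Qed.

Lemma primitive_C1 a b F f : a <= b -> (forall s, derivable F s 1) ->
  continuous f -> derive1 F = f -> primitive a b F f.
Proof.
move=> ab dF cf Ff.
have cf' u v : {within `[u, v], continuous f}.
  exact: continuous_subspaceT.
have cF : continuous F.
  by move=> s; apply: differentiable_continuous; exact/derivable1_diffP.
split; first exact: bmeas_continuous.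
move=> u v _ uv _; have [<-|nuv] := eqVneq u v.
  by rewrite set_itv1 Rintegral_set1 subrr.
rewrite /Rintegral (@continuous_FTC2 _ f F)//.
- by rewrite lt_neqAle nuv.
- by split => //; [apply: cvg_at_right_filter|apply: cvg_at_left_filter];
    exact: cF.
- by move=> s _; rewrite Ff.
Qed.

Lemma primitive_sqrt_bmeas a b F f : primitive a b F f ->
  bmeas a b (fun s => Num.sqrt (F s)).
Proof.
move=> /primitive_continuous/subspace_continuousP cF; apply: bmeas_continuous.
apply/subspace_continuousP => s /cF h.
by have h1 := @sqrt_continuous R (F s); apply: (cvg_comp _ _ h h1).
Qed.

(* With [p = sqrt (F u)] and [r = sqrt (F v)], the second-order remainder of
   [2/3 F^(3/2)] is [(r - p)^2 (2 r + p) / 3]. *)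
Lemma primitive_sqrt a b m F f : 0 < m ->
  {in `[a, b], forall s, m ^+ 2 <= F s} ->
  primitive a b F f ->
  primitive a b (fun s => 2 / 3 * (F s * Num.sqrt (F s)))
    (fun s => Num.sqrt (F s) * f s).
Proof.
move=> m0 mF pF; have [bf Ff] := pF.
have [L L0 FL] := primitive_lipschitz pF.
have sm s : s \in `[a, b] -> m <= Num.sqrt (F s).
  by move=> /mF ms; rewrite -(ger0_norm (ltW m0)) -sqrtr_sqr ler_wsqrtr.
have Fs s : s \in `[a, b] -> Num.sqrt (F s) ^+ 2 = F s.
  by move=> /mF ms; rewrite sqr_sqrtr// (le_trans _ ms)// sqr_ge0.
have bs := primitive_sqrt_bmeas pF.
have [_ [M fM]] := bf.
split; first exact: bmeasM.
move=> a' b' aa' a'b' b'b.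
apply: (@quadratic_increments_FTC _ _ _ (L ^+ 2 / m + L / m * M)
  (fun s => 2 / 3 * (F s * Num.sqrt (F s)))) => //.
  by apply: bmeas_sub aa' b'b _; exact: bmeasM.
move=> u v /(le_trans aa') au uv /le_trans/(_ b'b) vb.
have sub h : bmeas a b h -> bmeas u v h by exact: bmeas_sub.
(* The increment of [F] is that of its square root times a sum of two roots, and this sum is at
   least [m]. *)
have sqrt_lip s t : s \in `[a, b] -> t \in `[a, b] ->
    `|Num.sqrt (F s) - Num.sqrt (F t)| <= L / m * `|s - t|.
  move=> sab tab.
  have := FL _ _ tab sab; rewrite -{1}(Fs _ sab) -{1}(Fs _ tab) subr_sqr normrM.
  move=> h; rewrite mulrAC ler_pdivlMr//; apply: le_trans h.
  rewrite ler_wpM2l// ger0_norm ?addr_ge0 ?sqrtr_ge0//.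
  by rewrite (le_trans (sm _ sab))// lerDl sqrtr_ge0.
have uab : u \in `[a, b] by rewrite in_itv/= au (le_trans uv).
have vab : v \in `[a, b] by rewrite in_itv/= vb (le_trans au).
set p := Num.sqrt (F u); set r := Num.sqrt (F v).
have pm : m <= p by exact: sm.
have rm : m <= r by exact: sm.
have -> : 2 / 3 * (F v * r) - 2 / 3 * (F u * p) -
    \int[mu]_(s in `[u, v]) (Num.sqrt (F s) * f s) =
  (r - p) ^+ 2 * (2 * r + p) / 3 +
  \int[mu]_(s in `[u, v]) ((p - Num.sqrt (F s)) * f s).
  have -> : \int[mu]_(s in `[u, v]) ((p - Num.sqrt (F s)) * f s) =
      p * (F v - F u) - \int[mu]_(s in `[u, v]) (Num.sqrt (F s) * f s).
    rewrite Ff// -RintegralZb; last exact: sub.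
    rewrite -RintegralBb//;
      [|by apply/sub/bmeasM => //; exact: bmeas_cst|by apply/sub/bmeasM].
    by under eq_Rintegral do rewrite mulrBl.
  by rewrite -(Fs _ uab) -(Fs _ vab) -/p -/r; field.
rewrite (le_trans (ler_normD _ _))// [leRHS]mulrDl lerD//; last first.
  rewrite expr2 mulrA; apply: Rintegral_le => //.
    apply/sub/bmeasM => //; apply: bmeasB => //; exact: bmeas_cst.
  move=> s suv; have sab : s \in `[a, b].
    rewrite in_itv/= (le_trans au) ?(itvP suv)//.
    by rewrite (le_trans _ vb) ?(itvP suv).
  have us : `|u - s| <= v - u.
    by rewrite ler0_norm ?subr_le0 ?(itvP suv)// opprB lerB// (itvP suv).
  rewrite normrM mulrAC ler_pM ?fM//.
  by rewrite (le_trans (sqrt_lip _ _ _ _))// ler_wpM2l// divr_ge0// ltW.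
have := FL _ _ uab vab.
rewrite -{1}(Fs _ uab) -{1}(Fs _ vab) -/p -/r subr_sqr normrM.
rewrite [`|v - u|]ger0_norm ?subr_ge0// [`|r + p|]ger0_norm; last by lra.
move=> h.
(* This controls the remainder, since [(2 r + p) / 3] and [m] are both at most [r + p]. *)
have h2 : (`|r - p| * (r + p)) ^+ 2 <= (L * (v - u)) ^+ 2.
  have rp : 0 <= r + p by lra.
  by rewrite ler_sqr// nnegrE mulr_ge0// subr_ge0.
rewrite ger0_norm; last first.
  by rewrite divr_ge0// mulr_ge0 ?sqr_ge0//; lra.
rewrite [leRHS]mulrAC -exprMn ler_pdivlMr//; apply: le_trans h2.
rewrite exprMn real_normK ?num_real//.
have -> : (r - p) ^+ 2 * (2 * r + p) / 3 * m =
  (r - p) ^+ 2 * ((2 * r + p) / 3 * m) by ring.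
by rewrite ler_wpM2l ?sqr_ge0// [leRHS]expr2 ler_pM//; lra.
Qed.

End primitives.

(** * Weak derivatives and primitives *)

Section weak_derivatives.
Variable R : realType.
Implicit Types (a b u v M C : R) (f g F G w : R -> R).
Local Notation mu := (@lebesgue_measure R).

Lemma test_function_primitive a b phi : a <= b -> test_function a b phi ->
  [/\ primitive a b phi (derive1 phi), phi a = 0 & phi b = 0].
Proof.
move=> ab [dphi cphi [K [_ Kab phi0]]]; split; first exact: primitive_C1.
- by apply: phi0 => /Kab/=; rewrite in_itv/= ltxx.
- by apply: phi0 => /Kab/=; rewrite in_itv/= ltxx andbF.
Qed.

(** Integration by parts: the product rule for [F phi], whose boundary terms vanish. *)
Lemma primitive_weak_derivative a b F f : a <= b -> primitive a b F f ->
  weak_derivative a b F f.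
Proof.
move=> ab pF phi /(test_function_primitive ab)[pphi phia phib].
have [bf _] := pF; have [bphi' _] := pphi.
have bF := primitive_bmeas pF; have bphi := primitive_bmeas pphi.
have [_ /(_ a b (lexx _) ab (lexx _))] := primitiveM pF pphi.
rewrite RintegralDb; [|exact: bmeasM|exact: bmeasM].
rewrite phia phib !mulr0 subrr !Rintegral_open; [|exact: bmeasM|exact: bmeasM].
by move/esym/eqP; rewrite addr_eq0 => /eqP.
Qed.

(** * The du Bois-Reymond lemma *)

Lemma continuous_derivable_integral a f s : continuous f -> a < s ->
  derivable (fun r => \int[mu]_(t in `[a, r]) f t) s 1 /\
  derive1 (fun r => \int[mu]_(t in `[a, r]) f t) s = f s.
Proof.
move=> cf as_; apply: (@continuous_FTC1_closed _ _ _ _ (s + 1)) => //.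
  by rewrite ltrDl.
  apply: bmeas_integrable; apply: bmeas_continuous.
  exact: continuous_subspaceT.
exact: cf.
Qed.

Lemma near_eq_derive1 f g s : {near s, f =1 g} -> derive1 f s = derive1 g s.
Proof. by move=> fg; rewrite !derive1E (near_eq_derive (1 : R^o) fg). Qed.

(** The running integral is squeezed between 0 and the total integral, so it vanishes near [s],
    where its derivative is [f s]. *)
Lemma integral_continuous_eq0 a b f : continuous f -> (forall s, 0 <= f s) ->
  \int[mu]_(s in `[a, b]) f s = 0 -> forall s, s \in `]a, b[ -> f s = 0.
Proof.
move=> cf f0 If s; rewrite in_itv/= => /andP[as_ sb].
have bf u v : bmeas u v f by apply/bmeas_continuous/continuous_subspaceT.
have [_ <-] := continuous_derivable_integral cf as_.
rewrite (near_eq_derive1 (g := cst 0)) ?derive1_cst//.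
near=> r.
have ar : a <= r by apply: ltW; near: r; exact: lt_nbhsr.
have rb : r <= b by apply: ltW; near: r; exact: lt_nbhsl.
apply/eqP; rewrite eq_le Rintegral_ge0// andbT -If.
by rewrite (Rintegral_cat ar rb)// lerDl Rintegral_ge0.
Unshelve. all: by end_near. Qed.

(** Outside [[c, d]] the product is locally zero, so continuity of [f] is needed only inside []a,
    b[]. This makes the test function built below C^1 on the whole line. *)
Lemma continuous_cutoff a b c d f g : a < c -> d < b ->
  {in `]a, b[, continuous f} -> continuous g ->
  (forall s, s \notin `[c, d] -> g s = 0) ->
  continuous (fun s => f s * g s).
Proof.
move=> ac db cf cg g0 s.
have zero : (\forall r \near s, g r = 0) ->
    (fun s => f s * g s) @ s --> f s * g s.
  move=> gs; rewrite (nbhs_singleton gs) mulr0; apply: cvg_near_cst.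
  by apply: filterS gs => r ->; rewrite mulr0.
have [sc|cs] := ltP s c.
  apply: zero; near=> r; apply: g0; rewrite in_itv/= negb_and -!ltNge.
  by apply/orP; left; near: r; exact: lt_nbhsl.
have [ds|sd] := ltP d s.
  apply: zero; near=> r; apply: g0; rewrite in_itv/= negb_and -!ltNge.
  by apply/orP; right; near: r; exact: lt_nbhsr.
apply: cvgM; last exact: cg.
by apply: cf; rewrite in_itv/= (lt_le_trans ac)// (le_lt_trans sd).
Unshelve. all: by end_near. Qed.

(* The test function has derivative [(w - m) * eta], with [eta] a cutoff and [m]
   the [eta]-weighted mean of [w]; it makes [(w - m)^2 * eta] integrate to 0. *)
Lemma du_Bois_Reymond_interior a b w : {within `[a, b], continuous w} ->
  (forall phi, test_function a b phi ->
    \int[mu]_(s in `]a, b[) (w s * derive1 phi s) = 0) ->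
  {in `]a, b[ &, forall u v, w u = w v}.
Proof.
move=> cw wphi u v; wlog uv : u v / u <= v.
  by move=> W uab vab; have [/W|/ltW/W] := leP u v => ->.
rewrite !in_itv/= => /andP[au ub] /andP[av vb].
have ab : a < b by exact: lt_trans ub.
pose c := (a + u) / 2; pose d := (v + b) / 2.
have ac : a < c by rewrite /c; lra.
have cu : c < u by rewrite /c; lra.
have vd : v < d by rewrite /d; lra.
have db : d < b by rewrite /d; lra.
(* The positive part of a parabola is positive exactly on []c, d[], which contains [u] and [v]. *)
pose eta s := Num.max 0 ((s - c) * (d - s)).
have eta0 s : 0 <= eta s by rewrite le_max lexx.
have eta_out s : s \notin `[c, d] -> eta s = 0.
  rewrite in_itv/= negb_and -!ltNge => sout; apply: max_idPl.
  by case/orP: sout => h; nra.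
have eta_in s : s \in `]c, d[ -> 0 < eta s.
  rewrite in_itv/= => /andP[cs sd]; rewrite lt_max.
  by apply/orP; right; rewrite mulr_gt0// subr_gt0.
have ceta : continuous eta.
  move=> s; apply: (@continuous_max R R (fun=> 0) (fun s => (s - c) * (d - s))).
    exact: cvg_cst.
  apply: cvgM; apply: cvgB; by [exact: cvg_id|exact: cvg_cst].
have [cwo _ _] : [/\ {in `]a, b[, continuous w}, w x @[x --> a^'+] --> w a
    & w x @[x --> b^'-] --> w b] by exact/(continuous_within_itvP _ ab).
have bint h : continuous h -> bmeas a b h.
  by move=> ch; apply/bmeas_continuous/continuous_subspaceT.
have cweta := continuous_cutoff ac db cwo ceta eta_out.
pose A := \int[mu]_(s in `[a, b]) eta s.
have A0 : A != 0.
  apply/eqP => /(integral_continuous_eq0 ceta eta0)/(_ u).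
  rewrite in_itv/= au ub => /(_ isT) etau0.
  have : 0 < eta u by apply: eta_in; rewrite in_itv/= cu (le_lt_trans uv).
  by rewrite etau0 ltxx.
pose m := A^-1 * \int[mu]_(s in `[a, b]) (w s * eta s).
pose k s := w s * eta s - m * eta s.
have ck : continuous k.
  move=> s; apply: cvgB; first exact: cweta.
  by apply: cvgM; [exact: cvg_cst|exact: ceta].
have kE s : k s = (w s - m) * eta s by rewrite /k mulrBl.
have k_out s : s \notin `[c, d] -> k s = 0.
  by move=> /eta_out h; rewrite kE h mulr0.
have Ik : \int[mu]_(s in `[a, b]) k s = 0.
  rewrite RintegralBb;
    [|exact: bint|by apply: bmeasM; [exact: bmeas_cst|exact: bint]].
  rewrite RintegralZb; last exact: bint.
  by rewrite -/A /m mulrAC mulVf// mul1r subrr.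
pose phi s := \int[mu]_(t in `[a, s]) k t.
have phi_lt s : s < c -> phi s = 0.
  move=> sc; rewrite /phi (@eq_Rintegral _ _ _ _ _ (cst 0)).
    by rewrite Rintegral_cst//= mul0r.
  move=> t; rewrite inE/= => /= tas; apply: k_out.
  by rewrite in_itv/= negb_and -ltNge (le_lt_trans _ sc)// (itvP tas).
(* Beyond [d] nothing is added to the integral, so [phi s] is the total integral of [k], zero by the
   choice of [m]. *)
have phi_gt s : d < s -> phi s = 0.
  move=> ds.
  have bk u' v' : bmeas u' v' k by apply/bmeas_continuous/continuous_subspaceT.
  have tail r : d <= r -> \int[mu]_(t in `[d, r]) k t = 0.
    move=> dr; rewrite -Rintegral_itv_obnd_cbnd; last first.
      apply: integrableS (bmeas_integrable (bk d r)) => //.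
      by apply: subset_itvr; rewrite bnd_simp.
    rewrite (@eq_Rintegral _ _ _ _ _ (cst 0)).
      by rewrite Rintegral_cst//= mul0r.
    move=> t; rewrite inE/= => /= tas; apply: k_out.
    by rewrite in_itv/= negb_and -!ltNge (itvP tas) orbT.
  have ad : a <= d by lra.
  rewrite /phi (@Rintegral_cat _ a d s)// ?(ltW ds)// tail ?(ltW ds)//.
  rewrite addr0 -Ik (@Rintegral_cat _ a d b)// ?(ltW db)// tail ?(ltW db)//.
  by rewrite addr0.
(* The fundamental theorem applies only to the right of [a]; to the left of [c], [phi] is locally
   zero. *)
have dphi s : derivable phi s 1 /\ derive1 phi s = k s.
  have [sc|cs] := ltP s c; last first.
    by apply: continuous_derivable_integral => //; exact: lt_le_trans cs.
  have phis : \forall r \near s, phi r = cst 0 r.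
    by near=> r; apply: phi_lt; near: r; exact: lt_nbhsl.
  split.
    by apply: (near_eq_derivable (f := cst 0)) => //; near do apply/esym.
  rewrite (near_eq_derive1 phis) derive1_cst k_out//.
  by rewrite in_itv/= negb_and -!ltNge sc.
have phi' : derive1 phi = k by apply/funext => s; have [] := dphi s.
have tphi : test_function a b phi.
  split; first by move=> s; have [] := dphi s.
    by rewrite phi'.
  exists (`[c, d]%classic); split; first exact: segment_compact.
    by apply: subset_itv; rewrite bnd_simp.
  move=> s /negP; rewrite in_itv/= negb_and -!ltNge.
  by move=> /orP[]; [exact: phi_lt|exact: phi_gt].
have bw := bmeas_continuous cw.
have := wphi _ tphi.
rewrite phi' Rintegral_open; last by apply: bmeasM => //; exact: bint.
move=> Iwk.
have cwm : {in `]a, b[, continuous (fun s => w s - m)}.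
  by move=> s sab; apply: cvgB; [exact: cwo|exact: cvg_cst].
have cwmk := continuous_cutoff ac db cwm ck k_out.
have h0 s : 0 <= (w s - m) * k s.
  by rewrite kE mulrA -expr2 mulr_ge0// sqr_ge0.
have Iwmk : \int[mu]_(s in `[a, b]) ((w s - m) * k s) = 0.
  under eq_Rintegral do rewrite mulrBl.
  rewrite RintegralBb; [|by apply: bmeasM => //; exact: bint|
    by apply: bmeasM; [exact: bmeas_cst|exact: bint]].
  by rewrite RintegralZb; [|exact: bint]; rewrite Iwk Ik mulr0 subrr.
have wm s : s \in `]c, d[ -> w s = m.
  move=> scd; have := integral_continuous_eq0 cwmk h0 Iwmk (s := s).
  rewrite in_itv/= (lt_trans ac) ?(lt_trans _ db) ?(itvP scd)// => /(_ isT)/eqP.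
  rewrite kE mulrA -expr2 mulf_eq0 (gt_eqF (eta_in _ scd)) orbF sqrf_eq0.
  by rewrite subr_eq0 => /eqP.
by rewrite !wm// in_itv/= ?cu ?vd ?(lt_le_trans cu)// (le_lt_trans uv).
Unshelve. all: by end_near. Qed.

(** The interior constant reaches [a] and [b] through the one-sided limits of [w]; the midpoint
    serves as reference point. *)
Lemma du_Bois_Reymond a b w : a < b -> {within `[a, b], continuous w} ->
  (forall phi, test_function a b phi ->
    \int[mu]_(s in `]a, b[) (w s * derive1 phi s) = 0) ->
  {in `[a, b], forall s, w s = w a}.
Proof.
move=> ab cw wphi; have wint := du_Bois_Reymond_interior cw wphi.
have [_ wa wb] : [/\ {in `]a, b[, continuous w}, w x @[x --> a^'+] --> w a
    & w x @[x --> b^'-] --> w b] by exact/(continuous_within_itvP _ ab).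
pose m := (a + b) / 2.
have mab : m \in `]a, b[ by rewrite in_itv/= /m; apply/andP; split; lra.
have wam : w a = w m.
  apply: (cvg_unique _ wa) => //; apply: cvg_near_cst; near=> r.
  apply: wint => //; rewrite in_itv/=; apply/andP; split.
    by near: r; exact: nbhs_right_gt.
  by near: r; exact: nbhs_right_lt.
have wbm : w b = w m.
  apply: (cvg_unique _ wb) => //; apply: cvg_near_cst; near=> r.
  apply: wint => //; rewrite in_itv/=; apply/andP; split.
    by near: r; exact: nbhs_left_gt.
  by near: r; exact: nbhs_left_lt.
move=> s; rewrite in_itv/= => /andP[]; rewrite !le_eqVlt.
move=> /predU1P[<-//|as_] /predU1P[->|sb]; first by rewrite wam.
by rewrite wam; apply: wint; rewrite // in_itv/= as_.
Unshelve. all: by end_near. Qed.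

(** [F] minus the running integral of [f] has weak derivative 0, hence is constant. *)
Lemma weak_derivative_primitive a b F f : a < b ->
  {within `[a, b], continuous F} -> bmeas a b f -> weak_derivative a b F f ->
  primitive a b F f.
Proof.
move=> ab cF bf wF; have pG := primitive_integral bf.
set G := fun s => _ in pG.
have bF := bmeas_continuous cF; have bG := primitive_bmeas pG.
have cw : {within `[a, b], continuous (fun s => F s - G s)}.
  have cG := primitive_continuous pG.
  by move=> s; apply: cvgB; [exact: cF|exact: cG].
have wG := primitive_weak_derivative (ltW ab) pG.
have w0 phi : test_function a b phi ->
    \int[mu]_(s in `]a, b[) ((F s - G s) * derive1 phi s) = 0.
  move=> tphi; have [[bphi _] _ _] := test_function_primitive (ltW ab) tphi.
  have := wG _ tphi; rewrite -(wF _ tphi).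
  rewrite !Rintegral_open;
    try by [exact: bmeasM|apply: bmeasM => //; exact: bmeasB].
  under [in X in _ -> X]eq_Rintegral do rewrite mulrBl.
  by rewrite RintegralBb; [|exact: bmeasM|exact: bmeasM] => ->; rewrite subrr.
have FG := du_Bois_Reymond ab cw w0.
split=> // u v au uv vb.
have uab : u \in `[a, b] by rewrite in_itv/= au (le_trans uv).
have vab : v \in `[a, b] by rewrite in_itv/= vb (le_trans au).
have [_ <-//] := pG.
have := FG _ uab; have := FG _ vab; lra.
Qed.

(** The running integral of [f - g] is identically 0 on [[a, b]], while by Lebesgue differentiation
    its derivative is [f - g] almost everywhere. Extension by 0 gives a function integrable on the
    line. *)
Lemma primitive_ae_unique a b F f g : primitive a b F f -> primitive a b F g ->
  {ae mu, forall s, s \in `]a, b[ -> f s = g s}.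
Proof.
move=> [bf Ff] [bg Fg]; pose h : R -> R := (fun s => f s - g s) \_ `[a, b].
have bh : bmeas a b (fun s => f s - g s) by exact: bmeasB.
have ih := bmeas_integrable bh.
have ihT : mu.-integrable setT (EFin \o h).
  by rewrite -restrict_EFin; apply/integrable_restrict => //=; rewrite setTI.
have lh : locally_integrable setT h.
  exact: integrable_locally.
have hint0 (r : R) : a <= r -> r <= b -> \int[mu]_(t in `[a, r]) h t = 0.
  move=> ar rb; transitivity (\int[mu]_(t in `[a, r]) (f t - g t)).
    apply: eq_Rintegral => t; rewrite inE/= => /= tar.
    rewrite /h patchE mem_set//=.
    by rewrite in_itv/= (itvP tar)//= (le_trans _ rb) ?(itvP tar).
  have sub k : bmeas a b k -> bmeas a r k by exact: bmeas_sub.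
  by rewrite RintegralBb; [|exact: sub|exact: sub]; rewrite -Ff// -Fg// subrr.
have iy y : mu.-integrable [set` Interval (BLeft a) (BRight y)] (EFin \o h).
  exact: integrableS ihT.
have := FTC1 iy lh.
apply: filterS; first exact: (ae_filter_ringOfSetsType mu).
move=> s /= H; rewrite in_itv/= => /andP[as_ sb].
have /H[_ hs] : a < s by [].
apply/eqP; rewrite -subr_eq0; apply/eqP.
have -> : f s - g s = h s by rewrite /h patchE mem_set//= in_itv/= !ltW.
rewrite -hs (near_eq_derive1 (g := cst 0)) ?derive1_cst//.
near=> r.
have ar : a <= r by apply: ltW; near: r; exact: lt_nbhsr.
have rb : r <= b by apply: ltW; near: r; exact: lt_nbhsl.
exact: hint0.
Unshelve. all: by end_near. Qed.

End weak_derivatives.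

(** * Lipschitz representatives of W^{1,oo} curves *)

Section sobolev.
Variable R : realType.
Implicit Types (a b c d u v M C : R) (f g F G x y : R -> R).
Local Notation mu := (@lebesgue_measure R).

Lemma ae_itv_cc c d (P : R -> Prop) : {ae mu, forall s, s \in `]c, d[ -> P s} ->
  {ae mu, forall s, s \in `[c, d] -> P s}.
Proof.
move=> cdP.
have ne r : {ae mu, forall s, s <> r}.
  exists [set r]; split; [exact: measurable_set1|exact: lebesgue_measure_set1|].
  by move=> s /= /contrapT.
have FF := ae_filter_ringOfSetsType mu.
apply: filterS3 cdP (ne c) (ne d) => s Ps sc sd.
rewrite in_itv/= => /andP[cs sd'].
by apply: Ps; rewrite in_itv/= !lt_neqAle cs sd' !andbT; apply/andP; split;
  apply/eqP => // /esym.
Qed.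

Lemma ae_eq_Rintegral c d f g : bmeas c d f -> bmeas c d g ->
  {ae mu, forall s, s \in `]c, d[ -> f s = g s} ->
  \int[mu]_(s in `[c, d]) f s = \int[mu]_(s in `[c, d]) g s.
Proof.
move=> [mf _] [mg _] /ae_itv_cc fg; congr fine; apply: ae_eq_integral => //.
- exact/measurable_EFinP.
- exact/measurable_EFinP.
- have FF := ae_filter_ringOfSetsType mu.
  by apply: filterS fg => s /= fg /fg ->.
Qed.

(** Unfolding the norm of exponent [+oo] leaves a test on this inequality. *)
Lemma lebesgue_measure_setT_gt0 : (0 < mu setT)%E.
Proof.
apply: (@lt_le_trans _ _ (mu `[0, 1])).
  by rewrite lebesgue_measure_itv/= lte01 oppr0 adde0 lte01.
by apply: le_measure; rewrite ?inE.
Qed.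

Lemma Loo_bounded a b g : Loo a b g -> exists h,
  [/\ forall u v, bmeas u v h, measurable_fun `]a, b[ g &
      {ae mu, forall s, s \in `]a, b[ -> g s = h s}].
Proof.
rewrite /Loo => /andP[/[1!inE]/= mg].
rewrite inE/= /finite_norm unlock /Lnorm lebesgue_measure_setT_gt0.
move=> /ess_supr_bounded[M gM].
pose h s := Num.max (- `|M|) (Num.min `|M| ((g \_ `]a, b[) s)).
exists h; split.
- move=> u v; split.
    apply: (@measurable_funS _ _ _ _ setT) => //.
    apply: measurable_maxr; first exact: measurable_cst.
    by apply: measurable_minr => //; exact: measurable_cst.
  exists `|M| => s _; rewrite ler_norml /h le_max lexx/= ge_max.
  by rewrite ge_min lexx/= andbT; have := normr_ge0 M; lra.
- by apply/measurable_restrictT.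
- have FF := ae_filter_ringOfSetsType mu.
  apply: filterS gM => s /= gs sab.
  move: gs; rewrite patchE mem_set// => gs.
  have : `|g s| <= `|M| by exact: le_trans gs (ler_norm _).
  rewrite ler_norml /h patchE mem_set// => /andP[g1 g2].
  by rewrite min_r// max_r.
Qed.

Lemma bmeas_Loo a b f : bmeas a b f -> Loo a b f.
Proof.
move=> [mf [M fM]]; apply/andP; split.
  have mo : measurable_fun `]a, b[ f.
    by apply: measurable_funS mf => //; apply: subset_itv; rewrite bnd_simp.
  by rewrite inE/=; apply: (measurable_restrictT f (measurable_itv `]a, b[)).1.
rewrite inE/= /finite_norm unlock /Lnorm lebesgue_measure_setT_gt0.
apply: (@le_lt_trans _ _ `|M|%:E); last exact: ltry.
apply: ess_sup_ler => s; rewrite lee_fin patchE; case: ifPn => sab.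
  apply: le_trans (fM _ _) (ler_norm _).
  by move: sab; rewrite inE/=; exact: subset_itv_oo_cc.
by rewrite normr0.
Qed.

Lemma weak_derivative_ae a b x g h : a <= b -> measurable_fun `]a, b[ g ->
  bmeas a b h -> {ae mu, forall s, s \in `]a, b[ -> g s = h s} ->
  weak_derivative a b x g -> weak_derivative a b x h.
Proof.
move=> ab mg [mh _] gh wg phi tphi; rewrite (wg _ tphi); congr (- fine _).
have mphi : measurable_fun `]a, b[ phi.
  have [p _ _] := test_function_primitive ab tphi.
  have [m _] := primitive_bmeas p.
  by apply: measurable_funS m => //; apply: subset_itv; rewrite bnd_simp.
have mho : measurable_fun `]a, b[ h.
  by apply: measurable_funS mh => //; apply: subset_itv; rewrite bnd_simp.
apply: ae_eq_integral => //.
- by apply/measurable_EFinP/measurable_funM.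
- by apply/measurable_EFinP/measurable_funM.
- have FF := ae_filter_ringOfSetsType mu.
  by apply: filterS gh => s /= gh /gh ->.
Qed.

Lemma wderivP a b x : W1oo a b x ->
  Loo a b (wderiv a b x) /\ weak_derivative a b x (wderiv a b x).
Proof.
move=> [_ _ [g gL wg]]; rewrite /wderiv.
by case: xgetP => // /(_ g) [].
Qed.

(** This trades the arbitrarily chosen [wderiv] for a bounded [g] to which the calculus of
    primitives applies. *)
Lemma W1oo_primitive a b x : a < b -> W1oo a b x -> exists2 g,
  primitive a b x g & {ae mu, forall s, s \in `]a, b[ -> wderiv a b x s = g s}.
Proof.
move=> ab Wx; have [/Loo_bounded[g [bg mw wg]] ww] := wderivP Wx.
have [cx _ _] := Wx; exists g => //; apply: weak_derivative_primitive => //.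
exact: weak_derivative_ae (ltW ab) mw (bg _ _) wg ww.
Qed.

Lemma primitive_W1oo a b F f : a <= b -> primitive a b F f -> W1oo a b F.
Proof.
move=> ab pF; split; first exact: primitive_continuous pF.
  by apply: bmeas_Loo; exact: primitive_bmeas pF.
have [bf _] := pF; exists f; first exact: bmeas_Loo.
exact: primitive_weak_derivative.
Qed.

Lemma wderiv_primitive a b F f : a < b -> primitive a b F f ->
  {ae mu, forall s, s \in `]a, b[ -> wderiv a b F s = f s}.
Proof.
move=> ab pF; have [g pg wg] := W1oo_primitive ab (primitive_W1oo (ltW ab) pF).
have FF := ae_filter_ringOfSetsType mu.
apply: filterS2 (primitive_ae_unique pg pF) wg => s gf wg sab.
by rewrite wg// gf.
Qed.

End sobolev.

(** * The cost of a stage *)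

Section stages.
Variable R : realType.
Implicit Types (a b c d u v M C : R) (f g F G x y : R -> R).
Local Notation mu := (@lebesgue_measure R).

Lemma primitive_affine a b c1 :
  primitive a b (fun s => s / 2 + c1) (fun=> 2^-1 : R).
Proof.
apply: eq_primitive (primitive_lin 2^-1
  (primitive_cst a b c1) (primitive_id a b)).
- by move=> s _; rewrite addrC mulrC.
- by move=> s _; rewrite add0r mulr1.
Qed.

Lemma primitive_quadratic a b c1 c2 :
  primitive a b (fun s => s ^+ 2 / 4 + c1 * s + c2) (fun s => s / 2 + c1).
Proof.
have pid := primitive_id a b.
apply: eq_primitive (primitive_lin 4^-1
  (primitive_lin c1 (primitive_cst a b c2) pid) (primitiveM pid pid)).
- by move=> s _ /=; ring.
- by move=> s _ /=; field.
Qed.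

(** The difference quotient misses the derivative by exactly [(s - r) / 4], so interior points and
    endpoints are treated alike. *)
Lemma stage_derivative_quadratic a b c1 c2 x s :
  {in `[a, b], forall r, x r = r ^+ 2 / 4 + c1 * r + c2} -> s \in `[a, b] ->
  stage_derivative a b x s (s / 2 + c1).
Proof.
move=> xE sab; rewrite /stage_derivative; apply/cvgrPdist_le => e e0.
have FF : Filter (within `[a, b] s^') by exact: within_filter.
near=> r.
have rab : r \in `[a, b] by near: r; exact: withinT.
have rs : r != s by near: r; apply: cvg_within; exact: withinT.
have h : `|s - r| <= e.
  near: r; apply: cvg_within; apply: cvg_within; apply/nbhs_ballP.
  by exists e => // r; rewrite /ball/= => /ltW.
have -> : s / 2 + c1 - (x r - x s) / (r - s) = (s - r) / 4.
  by rewrite !xE//; field; rewrite subr_eq0.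
rewrite normrM [`|4^-1|]ger0_norm ?invr_ge0//; have := normr_ge0 (s - r); lra.
Unshelve. all: by end_near. Qed.

(* [x'^2 + x] is the square [(x' - p)^2] with [p = s / 2 + c1], up to the total
   derivative of [2 p x] and a term independent of [x]; [- 2 x' sqrt x] is the
   total derivative of [- 4/3 x^(3/2)]. *)
Lemma stage_square_completion c d c1 m x g : c <= d -> 0 < m ->
  {in `[c, d], forall s, m ^+ 2 <= x s} -> primitive c d x g ->
  \int[mu]_(s in `[c, d]) (g s - Num.sqrt (x s)) ^+ 2 =
  \int[mu]_(s in `[c, d]) (g s - (s / 2 + c1)) ^+ 2 +
  (2 * ((d / 2 + c1) * x d - 2 / 3 * (x d * Num.sqrt (x d)) -
        ((c / 2 + c1) * x c - 2 / 3 * (x c * Num.sqrt (x c)))) -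
   \int[mu]_(s in `[c, d]) (s / 2 + c1) ^+ 2).
Proof.
move=> cd m0 mx px; have [bg _] := px; have bs := primitive_sqrt_bmeas px.
have pp := primitive_affine c d c1; have bp := primitive_bmeas pp.
(* [w] is the derivative of [p x - 2/3 x^(3/2)], and pointwise
   [(g - sqrt x)^2 = (g - p)^2 + 2 w - p^2]. *)
have [bw /(_ c d (lexx _) cd (lexx _))] :=
  primitive_lin (-1) (primitiveM pp px) (primitive_sqrt m0 mx px).
set w := fun s => _ in bw *; rewrite !mulN1r => wE.
have bgp : bmeas c d (fun s => (g s - (s / 2 + c1)) ^+ 2).
  by apply: bmeasM; exact: bmeasB.
have bpp : bmeas c d (fun s => (s / 2 + c1) ^+ 2) by exact: bmeasM.
have b2w : bmeas c d (fun s => 2 * w s).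
  by apply: bmeasM => //; exact: bmeas_cst.
rewrite wE -RintegralZb// -RintegralBb// -RintegralDb//; last exact: bmeasB.
apply: eq_Rintegral => s; rewrite inE/= => scd.
have xs : Num.sqrt (x s) ^+ 2 = x s.
  by rewrite sqr_sqrtr// (le_trans _ (mx _ scd))// sqr_ge0.
by rewrite /w -{2}xs; field.
Qed.

Lemma residual_ae a b (f : R -> R -> R) x g : a < b -> primitive a b x g ->
  {ae mu, forall s, s \in `]a, b[ -> residual f a b x s = g s - f (x s) s}.
Proof.
move=> ab /(wderiv_primitive ab) wg.
have FF := ae_filter_ringOfSetsType mu.
by apply: filterS wg => s + sab; rewrite /residual => ->.
Qed.

Lemma stage_cost a b c d x g : a < b -> a <= c -> d <= b -> primitive a b x g ->
  (\int[mu]_(s in `[c, d])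
    (`|residual (fun r _ => Num.sqrt r) a b x s| ^+ 2)%:E)%E =
  (\int[mu]_(s in `[c, d]) (g s - Num.sqrt (x s)) ^+ 2)%:E.
Proof.
move=> ab ac db px; have [bg _] := px; have bs := primitive_sqrt_bmeas px.
have bq : bmeas c d (fun s => (g s - Num.sqrt (x s)) ^+ 2).
  by apply: (bmeas_sub ac db); apply: bmeasM; exact: bmeasB.
have [mq _] := bq.
rewrite /Rintegral fineK; last exact: integrable_fin_num (bmeas_integrable bq).
have [/Loo_bounded[_ [_ mw _]] _] := wderivP (primitive_W1oo (ltW ab) px).
apply: ae_eq_integral => //.
(* [wderiv] is known to be measurable only on the open interval, so the endpoints of the stage are
   added afterwards. *)
- apply: emeasurable_fun_itv_cc; apply/measurable_EFinP.
  have mr : measurable_fun `]c, d[ (residual (fun r _ => Num.sqrt r) a b x).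
    apply: measurable_funB.
      by apply: measurable_funS mw => //; apply: subset_itv; rewrite bnd_simp.
    have [ms _] := bs.
    by apply: measurable_funS ms => //; apply: subset_itv; rewrite bnd_simp.
  by apply: measurable_funX; apply: measurableT_comp => //; exact: mr.
- exact/measurable_EFinP.
- have FF := ae_filter_ringOfSetsType mu.
  have /= := ae_itv_cc (residual_ae (fun r _ => Num.sqrt r) ab px).
  apply: filterS => s /= H scd.
  rewrite H ?real_normK ?num_real//.
  by rewrite in_itv/= (le_trans ac) ?(le_trans _ db) ?(itvP scd).
Qed.

(** The cost is thus finite, so that costs compare as real numbers and common terms cancel. *)
Lemma PL2_costE N (t : nat -> R) x g : (forall i, (i < N)%N ->
    t 0%N <= t i /\ t i.+1 <= t N) -> t 0%N < t N ->
  primitive (t 0%N) (t N) x g ->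
  PL2_cost (fun r _ => Num.sqrt r) N t x =
  (2^-1 * \sum_(i < N)
    \int[mu]_(s in `[t i, t i.+1]) (g s - Num.sqrt (x s)) ^+ 2)%:E.
Proof.
move=> tt t0N px; rewrite /PL2_cost EFinM -sumEFin; congr (_ * _)%E.
apply: eq_bigr => i _; have [t0i tiN] := tt i (ltn_ord i).
exact: stage_cost.
Qed.

Lemma primitive_sqr_integral_eq0 c d f : bmeas c d f ->
  \int[mu]_(s in `[c, d]) f s ^+ 2 = 0 ->
  {ae mu, forall s, s \in `[c, d] -> f s = 0}.
Proof.
move=> bf If; have bff : bmeas c d (fun s => f s ^+ 2) by exact: bmeasM.
have [mff _] := bff.
have : (\int[mu]_(s in `[c, d]) `|(f s ^+ 2)%:E| = 0)%E.
  under eq_integral do rewrite gee0_abs ?lee_fin ?sqr_ge0//.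
  rewrite -[LHS]fineK; last exact: integrable_fin_num (bmeas_integrable bff).
  by rewrite -[0%E]/(0%:E); congr EFin.
move/ae_eq_integral_abs => /(_ (measurable_itv _)) H.
have /H{}H : measurable_fun `[c, d] (fun s => (f s ^+ 2)%:E).
  exact/measurable_EFinP.
have FF := ae_filter_ringOfSetsType mu.
apply: filterS H => s /= H scd.
by have [/eqP] := H scd; rewrite sqrf_eq0 => /eqP.
Qed.

End stages.

(** * The competitor and the minimizer *)

Section competitor.
Variable R : realType.
Implicit Types (a b c d u v M C : R) (f g F G x q p : R -> R).
Local Notation mu := (@lebesgue_measure R).

(** The bound is a square so that [m] bounds the square root of [x] from below, the form used by
    [primitive_sqrt]. *)
Lemma primitive_positive_lower_bound a b x g : a <= b -> primitive a b x g ->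
  (forall s, s \in `[a, b] -> 0 < x s) ->
  exists2 m, 0 < m & {in `[a, b], forall s, m ^+ 2 <= x s}.
Proof.
move=> ab px x0; have [r rab xr] := EVT_min ab (primitive_continuous px).
exists (Num.sqrt (x r)); first by rewrite sqrtr_gt0 x0.
by move=> s sab; rewrite sqr_sqrtr ?xr// ltW// x0.
Qed.

(* The correction [\int_a^s 1_[c, d] (p - g)] equals [q - x] on [c, d] and
   vanishes elsewhere, because [q] and [x] agree at [c] and [d]. *)
Lemma stage_correction a b c d x g q p : a <= c -> c < d -> d <= b ->
  primitive a b x g -> primitive a b q p -> q c = x c -> q d = x d ->
  exists h k, [/\ primitive a b h k,
    {in `[c, d], forall s, h s = q s - x s},
    {in `[c, d], forall s, k s = p s - g s},
    forall s, s \in `[a, b] -> s <= c \/ d <= s -> h s = 0 &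
    forall s, s \notin `[c, d] -> k s = 0].
Proof.
move=> ac cd db px pq qc qd; have [bg xE] := px; have [bp qE] := pq.
pose k : R -> R := (fun s => p s - g s) \_ `[c, d].
have kin : {in `[c, d], forall s, k s = p s - g s}.
  by move=> s scd; rewrite /k patchE mem_set.
have kout s : s \notin `[c, d] -> k s = 0.
  by move=> scd; rewrite /k patchE memNset//= => /(negP scd).
have bpg : bmeas a b (fun s => p s - g s) by exact: bmeasB.
have bk : bmeas a b k.
  have [mpg [M pgM]] := bpg; split.
    apply: (@measurable_funS _ _ _ _ setT) => //.
    apply: (measurable_restrictT _ (measurable_itv `[c, d])).1.
    by apply: measurable_funS mpg => //; apply: subset_itv; rewrite bnd_simp.
  exists `|M| => s sab; have [scd|scd] := boolP (s \in `[c, d]).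
    by rewrite kin// (le_trans (pgM _ sab))// ler_norm.
  by rewrite kout// normr0.
have ph := primitive_integral bk; set h := fun s => _ in ph.
have [_ hE] := ph.
have ab : a <= b by apply: le_trans db; apply: le_trans (ltW cd).
(* Only []u, v[] matters: [k] may be nonzero at an endpoint equal to [c] or [d]. *)
have zero u v : a <= u -> u <= v -> v <= b -> v <= c \/ d <= u ->
    \int[mu]_(s in `[u, v]) k s = 0.
  move=> au uv vb out; have sub := bmeas_sub au vb.
  rewrite (@ae_eq_Rintegral R u v k (fun=> 0)).
  - by rewrite Rintegral_cst//= mul0r.
  - exact: sub.
  - exact: bmeas_cst.
  - apply: nearW => s suv; apply: kout; rewrite in_itv/= negb_and -!ltNge.
    case: out => [vc|du]; apply/orP; [left|right].
      by rewrite (lt_le_trans _ vc)// (itvP suv).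
    by rewrite (le_lt_trans du)// (itvP suv).
have ha : h a = 0 by rewrite /h set_itv1 Rintegral_set1.
have cb : c <= b := le_trans (ltW cd) db.
have hc : h c = 0.
  by rewrite -[LHS]subr0 -ha hE// zero//; left.
have hcd : {in `[c, d], forall s, h s = q s - x s}.
  move=> s; rewrite in_itv/= => /andP[cs sd].
  have sb := le_trans sd db; have as_ := le_trans ac cs.
  rewrite -[LHS]subr0 -hc hE//.
  have -> : q s - x s = (q s - q c) - (x s - x c) by rewrite qc; ring.
  rewrite qE// xE// -RintegralBb; [|exact: bmeas_sub bp|exact: bmeas_sub bg].
  apply: eq_Rintegral => r; rewrite inE/= => /= rcs; apply: kin.
  by rewrite in_itv/= (itvP rcs)/= (le_trans _ sd) ?(itvP rcs).
exists h, k; split=> // s; rewrite in_itv/= => /andP[as_ sb] [sc|ds].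
  by rewrite -[LHS]subr0 -ha hE// zero//; left.
have hd : h d = 0 by rewrite hcd ?qd ?subrr// in_itv/= lexx ltW.
have ad : a <= d := le_trans ac (ltW cd).
by rewrite -[LHS]subr0 -hd hE// zero//; right.
Qed.

End competitor.

Lemma nodes_le (R : realType) (N : nat) (t : nat -> R)
  (ht : forall i, (i < N)%N -> t i < t i.+1) i j :
  (i <= j)%N -> (j <= N)%N -> t i <= t j.
Proof.
elim: j => [|j IH]; first by rewrite leqn0 => /eqP ->.
rewrite leq_eqVlt => /predU1P[->//|]; rewrite ltnS => ij jN.
by rewrite (le_trans (IH ij (ltnW jN)))// ltW// ht.
Qed.

(** * Optimality on a single stage *)

Section minimizer.
Variables (R : realType) (N : nat) (t z : nat -> R).
Hypothesis ht : forall i, (i < N)%N -> t i < t i.+1.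
Variables (x : R -> R) (i : nat).
Hypothesis hx : solves_PL2 (fun r _ : R => Num.sqrt r) N t z x.
Hypothesis hi : (i < N)%N.
Local Notation mu := (@lebesgue_measure R).

(** Coefficients of the parabola with leading coefficient 1/4 through the two skeleton points of the
    stage. *)
Let c1 := (t i.+1 - t i)^-1 *
  (z i.+1 - z i - (t i.+1 ^+ 2 - t i ^+ 2) / 4).
Let c2 := z i - t i ^+ 2 / 4 - t i * c1.

(** One fixed [e] in []0, 1[] suffices: with [A] the integral of [(g - p)^2] over the stage,
    minimality gives [A <= (1 - e)^2 A], which forces [A = 0]. *)
Lemma minimizer_derivative g : primitive (t 0%N) (t N) x g ->
  {ae mu, forall s, s \in `[t i, t i.+1] -> g s = s / 2 + c1}.
Proof.
move=> px; have [[Wx x0 xz] xmin] := hx.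
set a := t 0%N in px Wx x0 *; set b := t N in px Wx x0 *.
set c := t i; set d := t i.+1.
have cd : c < d by exact: ht.
have ac : a <= c by apply: (nodes_le ht) => //; exact: ltnW.
have db : d <= b by exact: (nodes_le ht).
have ab : a < b by exact: lt_le_trans (le_lt_trans ac cd) db.
pose p s := s / 2 + c1; pose q s := s ^+ 2 / 4 + c1 * s + c2.
have pq : primitive a b q p by exact: primitive_quadratic.
have xc : x c = z i by apply: xz; exact: ltnW.
have xd : x d = z i.+1 by exact: xz.
have qc : q c = x c by rewrite xc /q /c2 -/c; ring.
have qd : q d = x d.
  by rewrite xd /q /c2 /c1 -/c -/d; field; rewrite subr_eq0 gt_eqF.
have [h [k [ph hcd kcd hout kout]]] := stage_correction ac cd db px pq qc qd.
have [m m0 mx] := primitive_positive_lower_bound (ltW ab) px x0.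
have [_ [B hB]] := primitive_bmeas ph.
have B0 : 0 <= B.
  by apply: le_trans (normr_ge0 (h a)) (hB a _); rewrite in_itv/= lexx ltW.
have m20 : 0 < m ^+ 2 by rewrite exprn_gt0.
(* This choice gives [e < 1] and [e B < m^2], so [x + e h] stays positive since [m^2 <= x] and
   [|h| <= B]. *)
pose e := m ^+ 2 / (m ^+ 2 + B + 1).
have den0 : 0 < m ^+ 2 + B + 1 by lra.
have e0 : 0 < e by rewrite divr_gt0.
have e1 : e < 1 by rewrite ltr_pdivrMr//; lra.
have eB : e * B < m ^+ 2.
  by rewrite /e mulrAC ltr_pdivrMr// ltr_pM2l//; lra.
pose y s := x s + e * h s; pose gy s := g s + e * k s.
have py : primitive a b y gy by exact: primitive_lin.
have y0 s : s \in `[a, b] -> 0 < y s.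
  move=> sab; have := mx _ sab; have := hB _ sab.
  rewrite ler_norml => /andP[hl _].
  have : e * - B <= e * h s by rewrite ler_wpM2l// ltW.
  rewrite /y; lra.
have tab j : (j <= N)%N -> t j \in `[a, b].
  by move=> jN; rewrite in_itv/=; apply/andP; split; exact: (nodes_le ht).
have yz j : (j <= N)%N -> y (t j) = z j.
  move=> jN; rewrite /y hout ?mulr0 ?addr0 ?xz//; first exact: tab.
  (* No node lies strictly between [c] and [d], so the correction [h] vanishes at all nodes. *)
  have [ji|ij] := leqP j i; [left|right]; apply: (nodes_le ht) => //.
  exact: ltnW.
have yfeas : PL2_feasible N t z y.
  by split=> //; exact: primitive_W1oo (ltW ab) py.
have tt j : (j < N)%N -> t 0%N <= t j /\ t j.+1 <= t N.
  by move=> jN; split; apply: (nodes_le ht) => //; exact: ltnW.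
have [my my0 myy] := primitive_positive_lower_bound (ltW ab) py y0.
have := xmin y yfeas.
rewrite (PL2_costE tt ab px) (PL2_costE tt ab py) lee_fin ler_pM2l ?invr_gt0//.
rewrite (bigD1 (Ordinal hi))//= [leRHS](bigD1 (Ordinal hi))//=.
have bint f F u v : a <= u -> v <= b -> primitive a b F f ->
    bmeas u v (fun s => (f s - Num.sqrt (F s)) ^+ 2).
  move=> au vb pF; apply: bmeas_sub au vb _; have [bf _] := pF.
  by have bs := primitive_sqrt_bmeas pF; apply: bmeasM; exact: bmeasB.
(* The correction and its derivative vanish inside the other stages, whose costs therefore
   cancel. *)
have -> : \sum_(j < N | j != Ordinal hi)
      \int[mu]_(s in `[t j, t j.+1]) (gy s - Num.sqrt (y s)) ^+ 2 =
    \sum_(j < N | j != Ordinal hi)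
      \int[mu]_(s in `[t j, t j.+1]) (g s - Num.sqrt (x s)) ^+ 2.
  apply: eq_bigr => j ji; have [t0j tjN] := tt j (ltn_ord j).
  apply: ae_eq_Rintegral; [exact: bint|exact: bint|].
  apply: nearW => s sj.
  have sout : s < c \/ d < s.
    have : (j < i)%N || (i < j)%N.
      by rewrite -neq_ltn; apply: contra ji => /eqP ji; apply/eqP/val_inj.
    move=> /orP[ji'|ij]; [left|right].
      have /lt_le_trans : s < t j.+1 by rewrite (itvP sj).
      by apply; apply: (nodes_le ht) => //; exact: ltnW.
    have : t j < s by rewrite (itvP sj).
    by apply: le_lt_trans; apply: (nodes_le ht) => //; exact: ltnW.
  rewrite /gy /y kout ?hout ?mulr0 ?addr0//.
  - by rewrite in_itv/= (le_trans t0j) ?(le_trans _ tjN) ?(itvP sj).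
  - by case: sout => /ltW; [left|right].
  - by rewrite in_itv/= negb_and -!ltNge; case: sout => ->; rewrite ?orbT.
rewrite lerD2r.
have sub : {subset `[c, d] <= `[a, b]}.
  move=> s scd; rewrite in_itv/= (le_trans ac) ?(itvP scd)//.
  by rewrite (le_trans _ db) ?(itvP scd).
have mx' : {in `[c, d], forall s, m ^+ 2 <= x s} by move=> s /sub; exact: mx.
have my' : {in `[c, d], forall s, my ^+ 2 <= y s} by move=> s /sub; exact: myy.
have yc : y c = x c by rewrite xc yz// ltnW.
have yd : y d = x d by rewrite xd yz.
(* Since [x] and [y] agree at [c] and [d], both completions carry the same boundary terms. *)
rewrite (stage_square_completion c1 (ltW cd) m0 mx' (primitive_sub ac db px)).
rewrite (stage_square_completion c1 (ltW cd) my0 my' (primitive_sub ac db py)).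
rewrite yc yd lerD2r -/c -/d.
have bgp : bmeas c d (fun s => g s - (s / 2 + c1)).
  have [bg _] := px; apply: bmeasB; first exact: bmeas_sub bg.
  exact: primitive_bmeas (primitive_affine _ _ _).
have -> : \int[mu]_(s in `[c, d]) (gy s - (s / 2 + c1)) ^+ 2 =
    (1 - e) ^+ 2 * \int[mu]_(s in `[c, d]) (g s - (s / 2 + c1)) ^+ 2.
  rewrite -RintegralZb; last exact: bmeasM.
  apply: eq_Rintegral => s; rewrite inE/= => scd.
  by rewrite /gy kcd// /p; ring.
set A := \int[mu]_(s in _) _ => AA.
have A0 : 0 <= A by apply: Rintegral_ge0 => s _; exact: sqr_ge0.
(* This is the factor in [A - (1 - e)^2 A = e (2 - e) A]. *)
have f0 : 0 < e * (2 - e) by rewrite mulr_gt0//; lra.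
have {AA A0} A0 : A = 0.
  apply/eqP; rewrite eq_le A0 andbT -(pmulr_lle0 _ f0).
  have -> : A * (e * (2 - e)) = A - (1 - e) ^+ 2 * A by ring.
  by rewrite subr_le0.
have FF := ae_filter_ringOfSetsType mu.
have /= := primitive_sqr_integral_eq0 bgp A0.
by apply: filterS => s H scd; apply/eqP; rewrite -subr_eq0; apply/eqP/H.
Qed.

(** Integrate the almost-everywhere derivative from [t i] to [s]; [c2] matches the value [z i] at
    [t i]. *)
Lemma minimizer_quadratic g : primitive (t 0%N) (t N) x g ->
  {in `[t i, t i.+1], forall s, x s = s ^+ 2 / 4 + c1 * s + c2}.
Proof.
move=> px s; rewrite in_itv/= => /andP[cs sd].
have [[_ _ xz] _] := hx; have gE := minimizer_derivative px.
have t0i : t 0%N <= t i by apply: (nodes_le ht) => //; exact: ltnW.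
have tiN : t i.+1 <= t N by exact: (nodes_le ht).
have sN := le_trans sd tiN.
have [bg xE] := px.
have [bp qE] := primitive_quadratic (t i) s c1 c2.
have := xE (t i) s t0i cs sN.
rewrite (@ae_eq_Rintegral _ _ _ _ (fun r => r / 2 + c1)) => //.
- rewrite -qE// xz; last exact: ltnW.
  rewrite /c2; lra.
- exact: bmeas_sub bg.
- have FF := ae_filter_ringOfSetsType mu.
  apply: filterS gE => r /= H rts; apply: H.
  by rewrite in_itv/= !ltW ?(itvP rts)// (lt_le_trans _ sd) ?(itvP rts).
Qed.

End minimizer.

Theorem proposition4 (R : realType) (N : nat) (t z : nat -> R)
  (hN : (0 < N)%N)
  (ht0 : t 0%N = 0)
  (ht : forall i, (i < N)%N -> t i < t i.+1)
  (hz0 : z 0%N = 1)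
  (hz : forall i, (i <= N)%N -> 0 < z i)
  (hzne : forall i, (i < N)%N -> z i.+1 <> z i)
  (x : R -> R)
  (hx : solves_PL2 (fun (y _ : R) => Num.sqrt y) N t z x) :
  forall i, (i < N)%N ->
    let c1 := (t i.+1 - t i)^-1 *
              (z i.+1 - z i - (t i.+1 ^+ 2 - t i ^+ 2) / 4) in
    let c2 := z i - t i ^+ 2 / 4 - t i * c1 in
    [/\ forall s, s \in `[t i, t i.+1] -> x s = s ^+ 2 / 4 + c1 * s + c2,
        forall s, s \in `[t i, t i.+1] ->
          stage_residual (fun (y _ : R) => Num.sqrt y) (t i) (t i.+1) x s
            (s / 2 + c1 - Num.sqrt (x s)) &
        {ae lebesgue_measure, forall s, s \in `[t i, t i.+1] ->
          residual (fun (y _ : R) => Num.sqrt y) (t 0%N) (t N) x s =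
            s / 2 + c1 - Num.sqrt (x s)}].
Proof.
move=> i hi c1 c2.
have t0i : t 0%N <= t i by apply: (nodes_le ht) => //; exact: ltnW.
have tiN : t i.+1 <= t N by exact: (nodes_le ht).
have ab : t 0%N < t N by exact: lt_le_trans (le_lt_trans t0i (ht _ hi)) tiN.
have [[Wx _ _] _] := hx; have [g px _] := W1oo_primitive ab Wx.
have xE := minimizer_quadratic ht hx hi px.
split=> //.
  move=> s sI; exists (s / 2 + c1) => //.
  exact: stage_derivative_quadratic xE sI.
(* [residual] uses the weak derivative on the whole time interval, equal almost everywhere to [g],
   which is [s / 2 + c1] almost everywhere on the stage. *)
have FF := ae_filter_ringOfSetsType (@lebesgue_measure R).
have gE := minimizer_derivative ht hx hi px.
have rE := ae_itv_cc (residual_ae (fun r _ => Num.sqrt r) ab px).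
apply: filterS2 rE gE => s /= rE gE sI.
by rewrite rE ?gE// in_itv/= (le_trans t0i) ?(le_trans _ tiN) ?(itvP sI).
Qed.
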